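(* (i) Let $\mathcal M=(\mathcal D,\mathrm x)$ be a minimal time-like surface in $\mathbb R^n_1$ given in isothermal coordinates $(u,v)\in\mathcal D$ (with $E<0$). Then $\mathrm x$ is represented locally in the form $$\mathrm x(u,v)=\mathrm{Re}\,\Psi(t),$$ where $\Psi$ is a holomorphic $\mathbb D^n_1$-valued function of $t=u+\mathrm jv$ satisfying $$\Psi'^{\,2}=0,\qquad \|\Psi'\|^2<0.$$ (ii) Conversely, if $\Psi$ is a holomorphic $\mathbb D^n_1$-valued function defined in a domain $\mathcal D\subset\mathbb D$ and satisfying $\Psi'^{\,2}=0$ and $\|\Psi'\|^2<0$, then the pair $(\mathcal D,\mathrm x)$ with $\mathrm x(u,v)=\mathrm{Re}\,\Psi(t)$, $t=u+\mathrm jv$, is a minimal time-like surface in $\mathbb R^n_1$ parametrized by isothermal coordinates $(u,v)$.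
   Context: $\mathbb D=\{t=u+\mathrm j v:\ u,v\in\mathbb R\}$ with $\mathrm j^2=1$ is the algebra of double numbers; $\bar t=u-\mathrm jv$, $\mathrm{Re}\,t=u$, $|t|^2=t\bar t$; $\frac{\partial}{\partial t}=\frac12\left(\frac{\partial}{\partial u}+\mathrm j\frac{\partial}{\partial v}\right)$, $\frac{\partial}{\partial\bar t}=\frac12\left(\frac{\partial}{\partial u}-\mathrm j\frac{\partial}{\partial v}\right)$; a (smooth, possibly vector-valued) function $f$ is holomorphic if $\frac{\partial f}{\partial\bar t}=0$, and then $f'=\frac{\partial f}{\partial t}$. $\mathbb R^n_1$ is $\mathbb R^n$ with $a\cdot b=-a_1b_1+a_2b_2+\dots+a_nb_n$; $\mathbb D^n_1=\mathbb D^n$ with the $\mathbb D$-bilinear extension of this product; for $a\in\mathbb D^n_1$, $a^2=a\cdot a\in\mathbb D$ and $\|a\|^2=a\cdot\bar a\in\mathbb R$. A time-like surface $\mathcal M=(\mathcal D,\mathrm x)$ in $\mathbb R^n_1$ is given by a smooth immersion $\mathrm x(u,v):\mathcal D\to\mathbb R^n_1$ of a domain $\mathcal D\subset\mathbb R^2\cong\mathbb D$ whose induced metric is indefinite. With $E=\mathrm x_u^2$, $F=\mathrm x_u\cdot\mathrm x_v$, $G=\mathrm x_v^2$, the coordinates are isothermal if $E=-G$, $F=0$; the standing convention is $E<0$. The second fundamental form is $\sigma(X,Y)=(\nabla_XY)^\bot$, where $\nabla$ is the canonical flat connection of $\mathbb R^n_1$; the mean curvature is $\mathrm H=\frac12(-\sigma(X_1,X_1)+\sigma(X_2,X_2))$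 for an orthonormal tangent basis with $X_1^2=-1$, $X_2^2=1$. The surface is minimal if $\mathrm H=0$ everywhere. *)

(* Defs.v *)
From HB Require Import structures.
From mathcomp Require Import all_boot all_order all_algebra.
From mathcomp Require Import all_classical all_reals all_analysis.
From mathcomp Require Import ring lra.
Set Implicit Arguments.
Unset Strict Implicit.
Unset Printing Implicit Defensive.
Import Order.TTheory GRing.Theory Num.Theory.
Import numFieldNormedType.Exports.
Local Open Scope classical_set_scope.
Local Open Scope ring_scope.

(* [Double u v] is u + j v, with j ^+ 2 = 1. *)
Record dnum (R : Type) : Type := Double { Dre : R; Dim : R }.

Definition pair_of_dnum (R : Type) (t : dnum R) : R * R := (Dre t, Dim t).
Definition dnum_of_pair (R : Type) (p : R * R) : dnum R := Double p.1 p.2.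

Lemma pair_of_dnumK (R : Type) :
  cancel (@pair_of_dnum R) (@dnum_of_pair R).
Proof. by case. Qed.

HB.instance Definition _ (R : eqType) := Equality.copy (dnum R)
  (can_type (@pair_of_dnumK R)).
HB.instance Definition _ (R : choiceType) := Choice.copy (dnum R)
  (can_type (@pair_of_dnumK R)).

Section DnumRing.
Variable R : comNzRingType.
Implicit Types s t : dnum R.

Definition addd s t := Double (Dre s + Dre t) (Dim s + Dim t).
Definition oppd t := Double (- Dre t) (- Dim t).
Definition muld s t :=
  Double (Dre s * Dre t + Dim s * Dim t) (Dre s * Dim t + Dim s * Dre t).

Lemma adddA : associative addd.
Proof. by move=> [a b] [c d] [e f]; rewrite /addd /= !addrA. Qed.
Lemma adddC : commutative addd.
Proof. by move=> [a b] [c d]; congr Double; rewrite addrC. Qed.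
Lemma add0d : left_id (Double 0 0) addd.
Proof. by move=> [a b]; rewrite /addd /= !add0r. Qed.
Lemma addNd : left_inverse (Double 0 0) oppd addd.
Proof. by move=> [a b]; rewrite /addd /= !addNr. Qed.

HB.instance Definition _ :=
  GRing.isZmodule.Build (dnum R) adddA adddC add0d addNd.

Lemma muldA : associative muld.
Proof. by move=> [a b] [c d] [e f]; congr Double => /=; ring. Qed.
Lemma muldC : commutative muld.
Proof. by move=> [a b] [c d]; congr Double => /=; ring. Qed.
Lemma mul1d : left_id (Double 1 0) muld.
Proof. by move=> [a b]; congr Double => /=; ring. Qed.
Lemma muldDl : left_distributive muld addd.
Proof. by move=> [a b] [c d] [e f]; congr Double => /=; ring. Qed.
Lemma oned_neq0 : Double 1 0 != 0 :> dnum R.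
Proof. by apply/eqP => -[] /eqP; rewrite oner_eq0. Qed.

HB.instance Definition _ := GRing.Zmodule_isComNzRing.Build (dnum R)
  muldA muldC mul1d muldDl oned_neq0.

Definition Dj : dnum R := Double 0 1.
Definition Dreal (a : R) : dnum R := Double a 0.
Definition Dconj t : dnum R := Double (Dre t) (- Dim t).

Lemma Dj_sqr : Dj * Dj = 1.
Proof. by congr Double => /=; ring. Qed.

Lemma DoubleE u v : Double u v = Dreal u + Dj * Dreal v.
Proof. by congr Double => /=; ring. Qed.

End DnumRing.
Arguments Dj {R}.

Section Minkowski.
Variable n : nat.

(* - a_1 b_1 + a_2 b_2 + ... + a_n b_n; taking K := dnum R gives the
   bilinear extension of the product from R^n to (dnum R)^n. *)
Definition mdot (K : pzRingType) (a b : 'rV[K]_n) : K :=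
  \sum_(i < n) (-1) ^+ (i == 0 :> nat) * (a 0 i * b 0 i).

Definition rowRe (R : Type) (a : 'rV[dnum R]_n) : 'rV[R]_n := map_mx (@Dre R) a.
Definition rowIm (R : Type) (a : 'rV[dnum R]_n) : 'rV[R]_n := map_mx (@Dim R) a.
Definition rowD (R : Type) (a b : 'rV[R]_n) : 'rV[dnum R]_n :=
  map2_mx (@Double R) a b.

Definition Dsq (R : comNzRingType) (a : 'rV[dnum R]_n) : dnum R := mdot a a.

(* a . conj a is a real double number, see [mdot_conj]. *)
Definition Dnormsq (R : comNzRingType) (a : 'rV[dnum R]_n) : R :=
  Dre (mdot a (map_mx (@Dconj R) a)).

Lemma mdot_conj (R : comNzRingType) (a : 'rV[dnum R]_n) :
  mdot a (map_mx (@Dconj R) a) = Dreal (Dnormsq a).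
Proof.
suff h : Dim (mdot a (map_mx (@Dconj R) a)) = 0.
  by rewrite /Dnormsq; case: (mdot _ _) h => u v /= ->.
rewrite /mdot; elim/big_ind: _ => //= [[s s'] [t t'] /= -> ->|i _].
  by rewrite addr0.
rewrite !mxE; case: (a 0 i) => u v.
by case: (_ == _); rewrite ?expr0 ?expr1 /=; ring.
Qed.

End Minkowski.

Section Orthogonal.
Variables (F : fieldType) (n : nat).
Implicit Types (a b c w : 'rV[F]_n) (k : F).

Lemma mdotC a b : mdot a b = mdot b a.
Proof. by apply: eq_bigr => i _; rewrite [a 0 i * _]mulrC. Qed.

Lemma mdotDl a b c : mdot (a + b) c = mdot a c + mdot b c.
Proof. by rewrite -big_split; apply: eq_bigr => i _; rewrite mxE mulrDl mulrDr. Qed.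

Lemma mdotZl k a c : mdot (k *: a) c = k * mdot a c.
Proof. by rewrite /mdot mulr_sumr; apply: eq_bigr => i _; rewrite mxE -mulrA mulrCA. Qed.

Definition gram a b : F := mdot a a * mdot b b - mdot a b ^+ 2.

(* The component of w orthogonal to the plane spanned by a and b, when the
   product is nondegenerate on that plane; see [orth_partP]. *)
Definition orth_part a b w : 'rV[F]_n :=
  w - ((mdot b b * mdot w a - mdot a b * mdot w b) / gram a b *: a
       + (mdot a a * mdot w b - mdot a b * mdot w a) / gram a b *: b).

Lemma orth_partP a b w : gram a b != 0 ->
  [/\ mdot (orth_part a b w) a = 0, mdot (orth_part a b w) b = 0 &
      exists s t, w = s *: a + t *: b + orth_part a b w].
Proof.
move=> g0; split; last by do 2!eexists; apply/esym; rewrite addrC; exact: subrK.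
- rewrite /orth_part -scaleN1r !(mdotDl, mdotZl) (mdotC b a).
  by move: g0; rewrite /gram; move: (mdot a a) (mdot a b) (mdot b b) => e f g g0; field.
- rewrite /orth_part -scaleN1r !(mdotDl, mdotZl).
  by move: g0; rewrite /gram; move: (mdot a a) (mdot a b) (mdot b b) => e f g g0; field.
Qed.

Lemma orth_partD a b w1 w2 :
  orth_part a b (w1 + w2) = orth_part a b w1 + orth_part a b w2.
Proof.
rewrite /orth_part [RHS]addrACA -opprD; congr (_ - _).
rewrite [RHS]addrACA -!scalerDl !mdotDl.
by congr (_ *: _ + _ *: _); ring.
Qed.

Lemma orth_partZ a b k w : orth_part a b (k *: w) = k *: orth_part a b w.
Proof.
rewrite /orth_part scalerBr; congr (_ - _).
rewrite scalerDr !scalerA !mdotZl.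
by congr (_ *: _ + _ *: _); ring.
Qed.

Lemma orth_part_span a b s t : gram a b != 0 ->
  orth_part a b (s *: a + t *: b) = 0.
Proof.
move=> g0; apply/eqP; rewrite subr_eq0; apply/eqP.
rewrite !mdotDl !mdotZl (mdotC b a); move: g0; rewrite /gram.
move: (mdot a a) (mdot a b) (mdot b b) => e f g g0.
by congr (_ *: _ + _ *: _); field.
Qed.

Lemma orth_part_quad a b k l w1 w2 w3 w4 :
  orth_part a b (k *: (k *: w1 + l *: w2) + l *: (k *: w3 + l *: w4)) =
  k ^+ 2 *: orth_part a b w1 + (k * l) *: (orth_part a b w2 + orth_part a b w3)
  + l ^+ 2 *: orth_part a b w4.
Proof.
rewrite !(orth_partD, orth_partZ) !scalerDr !scalerA !addrA.
by rewrite (mulrC l k) -!expr2.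
Qed.

End Orthogonal.

Section Calculus.
Variable R : realType.

Lemma derivable_scale (U : normedModType R) n (a : U -> R) (f : U -> 'rV[R]_n)
    (p e : U) : derivable a p e -> derivable f p e ->
  derivable (fun q => a q *: f q) p e /\
  'D_e (fun q => a q *: f q) p = 'D_e a p *: f p + a p *: 'D_e f p.
Proof.
move=> da df.
have df_ i : derivable (fun q => f q 0 i) p e by move/derivable_mxP : df; apply.
have h i : (fun q => (a q *: f q) 0 i) = a * (fun q => f q 0 i).
  by apply/funext => q; rewrite mxE.
have h1 : derivable (fun q => a q *: f q) p e.
  apply/derivable_mxP => i j; rewrite (ord1 i) h.
  exact: (@derivableM R U a (fun q => f q 0 j) p e da (df_ j)).
split=> //; rewrite (derive_mx h1) (derive_mx df); apply/rowP => i.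
rewrite !mxE h (@deriveM R U a (fun q => f q 0 i) p e da (df_ i)) addrC.
by congr (_ + _); exact: mulrC.
Qed.

Lemma derive_lincomb (U : normedModType R) n (f g : U -> 'rV[R]_n) (k l : R)
    (p e : U) : derivable f p e -> derivable g p e ->
  'D_e (fun q => k *: f q + l *: g q) p = k *: 'D_e f p + l *: 'D_e g p.
Proof.
move=> df dg; rewrite -(deriveZ k df) -(deriveZ l dg).
exact: deriveD (derivableZ df) (derivableZ dg).
Qed.

Definition domain (D : set (R * R)) : Prop :=
  [/\ open D, connected D & D !=set0].

Section Partial.
Variable V : normedModType R.
Implicit Types (f : R * R -> V) (p : R * R).

Definition du f p : V := 'D_((1, 0) : R * R) f p.
Definition dv f p : V := 'D_((0, 1) : R * R) f p.

Definition pderivable f p : Prop :=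
  derivable f p ((1, 0) : R * R) /\ derivable f p ((0, 1) : R * R).

Fixpoint Ck (k : nat) (D : set (R * R)) f : Prop :=
  (forall p, D p -> {for p, continuous f}) /\
  match k with
  | 0 => True
  | k'.+1 =>
      [/\ forall p, D p -> pderivable f p, Ck k' D (du f) & Ck k' D (dv f)]
  end.

Definition smooth (D : set (R * R)) f : Prop := forall k, Ck k D f.

End Partial.

Section Holomorphic.
Variable n : nat.
Implicit Types (Psi : dnum R -> 'rV[dnum R]_n) (p : R * R).

Definition Ddu Psi p : 'rV[dnum R]_n :=
  rowD (du (fun q => rowRe (Psi (dnum_of_pair q))) p)
       (du (fun q => rowIm (Psi (dnum_of_pair q))) p).
Definition Ddv Psi p : 'rV[dnum R]_n :=
  rowD (dv (fun q => rowRe (Psi (dnum_of_pair q))) p)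
       (dv (fun q => rowIm (Psi (dnum_of_pair q))) p).

Definition Dd Psi p : 'rV[dnum R]_n :=
  Dreal 2^-1 *: (Ddu Psi p + Dj *: Ddv Psi p).
Definition Ddbar Psi p : 'rV[dnum R]_n :=
  Dreal 2^-1 *: (Ddu Psi p - Dj *: Ddv Psi p).

Definition holomorphic (D : set (R * R)) Psi : Prop :=
  [/\ smooth D (fun q => rowRe (Psi (dnum_of_pair q))),
      smooth D (fun q => rowIm (Psi (dnum_of_pair q))) &
      forall p, D p -> Ddbar Psi p = 0].

End Holomorphic.

Section Surface.
Variables (n : nat) (x : R * R -> 'rV[R]_n).
Implicit Types (p X Y : R * R).

Definition coefE p : R := mdot (du x p) (du x p).
Definition coefF p : R := mdot (du x p) (dv x p).
Definition coefG p : R := mdot (dv x p) (dv x p).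

(* Tangent vectors at p are given by their coordinates in (x_u, x_v). *)
Definition tvec p X : 'rV[R]_n := X.1 *: du x p + X.2 *: dv x p.

Definition metric p X Y : R := mdot (tvec p X) (tvec p Y).

Definition timelike_surface (D : set (R * R)) : Prop :=
  [/\ domain D,
      smooth D x,
      forall p, D p -> injective (tvec p) &
      forall p, D p ->
        (exists X, metric p X X < 0) /\ (exists Y, 0 < metric p Y Y)].

Definition isothermal (D : set (R * R)) : Prop :=
  forall p, D p -> [/\ coefE p = - coefG p, coefF p = 0 & coefE p < 0].

(* Tangent vector fields X, Y are given by their coordinate functions; this is
   the derivative of the R^n-valued map Y along X. *)
Definition nabla (X Y : R * R -> R * R) p : 'rV[R]_n :=
  (X p).1 *: du (fun q => tvec q (Y q)) p +
  (X p).2 *: dv (fun q => tvec q (Y q)) p.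

Definition second_form (X Y : R * R -> R * R) p : 'rV[R]_n :=
  orth_part (du x p) (dv x p) (nabla X Y p).

Definition orthonormal p X1 X2 : Prop :=
  [/\ metric p X1 X1 = - 1, metric p X2 X2 = 1 & metric p X1 X2 = 0].

Lemma gramE p : gram (du x p) (dv x p) = coefE p * coefG p - coefF p ^+ 2.
Proof. by []. Qed.

Lemma metricE p X Y : metric p X Y = X.1 * Y.1 * coefE p
  + (X.1 * Y.2 + X.2 * Y.1) * coefF p + X.2 * Y.2 * coefG p.
Proof.
rewrite /metric /tvec /coefE /coefF /coefG.
move: (du x p) (dv x p) => a b; case: X Y => [s t] [s' t'] /=.
rewrite mdotDl !mdotZl !(mdotC _ (_ + _)) !mdotDl !mdotZl (mdotC b a).
by move: (mdot a a) (mdot a b) (mdot b b) => e f g; ring.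
Qed.

Lemma second_form_tensorial (X Y : R * R -> R * R) p :
  gram (du x p) (dv x p) != 0 ->
  pderivable (fun q => (Y q).1) p -> pderivable (fun q => (Y q).2) p ->
  pderivable (du x) p -> pderivable (dv x) p ->
  second_form X Y p = second_form (cst (X p)) (cst (Y p)) p.
Proof.
move=> g0 [y1 y1'] [y2 y2'] [xu xu'] [xv xv'].
have main (e : R * R) : derivable (fun q => (Y q).1) p e ->
    derivable (fun q => (Y q).2) p e -> derivable (du x) p e ->
    derivable (dv x) p e -> orth_part (du x p) (dv x p) ('D_e (fun q => tvec q (Y q)) p)
    = orth_part (du x p) (dv x p) ('D_e (fun q => tvec q (Y p)) p).
  clear y1 y1' y2 y2' xu xu' xv xv' => y1 y2.
  rewrite /tvec; move: (du x) (dv x) g0 => xu xv g0 dxu dxv.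
  have [d1 e1] := derivable_scale y1 dxu.
  have [d2 e2] := derivable_scale y2 dxv.
  move: (deriveD d1 d2); rewrite e1 e2 => E1.
  have -> : 'D_e (fun q => (Y q).1 *: xu q + (Y q).2 *: xv q) p
      = ('D_e (fun q => (Y q).1) p *: xu p + 'D_e (fun q => (Y q).2) p *: xv p)
        + ((Y p).1 *: 'D_e xu p + (Y p).2 *: 'D_e xv p).
    by rewrite addrACA -E1.
  rewrite (derive_lincomb _ _ dxu dxv).
  by rewrite orth_partD orth_part_span // add0r.
have lin (a b w1 w2 w1' w2' : 'rV[R]_n) k l : orth_part a b w1 = orth_part a b w1' ->
    orth_part a b w2 = orth_part a b w2' ->
    orth_part a b (k *: w1 + l *: w2) = orth_part a b (k *: w1' + l *: w2').
  by move=> h1 h2; rewrite !orth_partD !orth_partZ h1 h2.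
have mu : orth_part (du x p) (dv x p) (du (fun q => tvec q (Y q)) p)
    = orth_part (du x p) (dv x p) (du (fun q => tvec q (Y p)) p).
  exact: (main _ y1 y2 xu xv).
have mv : orth_part (du x p) (dv x p) (dv (fun q => tvec q (Y q)) p)
    = orth_part (du x p) (dv x p) (dv (fun q => tvec q (Y p)) p).
  exact: (main _ y1' y2' xu' xv').
exact: lin mu mv.
Qed.

(* The vectors X1, X2 are extended to fields with constant coordinates, which is
   immaterial by [second_form_tensorial]; an orthonormal basis exists and H does
   not depend on it, see [mean_curvature_exists] and [mean_curvature_unique]. *)
Definition is_mean_curvature p (H : 'rV[R]_n) : Prop :=
  exists X1 X2 : R * R, orthonormal p X1 X2 /\
    H = 2^-1 *: (- second_form (cst X1) (cst X1) p
                 + second_form (cst X2) (cst X2) p).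

Lemma gram_neq0 p X1 X2 : orthonormal p X1 X2 -> gram (du x p) (dv x p) != 0.
Proof.
rewrite gramE => -[]; rewrite !metricE; move: (coefE p) (coefF p) (coefG p) => e f g h1 h2 h3.
apply/negP => /eqP g0.
have : (X1.1 * X2.2 - X1.2 * X2.1) ^+ 2 * (e * g - f ^+ 2) = -1.
  rewrite [RHS](_ : -1 = (-1) * 1 - 0 ^+ 2 :> R); last by ring.
  by rewrite -[in RHS]h3 -[in RHS]h1 -[in RHS]h2; ring.
by rewrite g0 mulr0 => /eqP; rewrite eq_sym oppr_eq0 oner_eq0.
Qed.

Lemma orthonormal_inv p X1 X2 : orthonormal p X1 X2 ->
  let g := gram (du x p) (dv x p) in
  [/\ - X1.1 ^+ 2 + X2.1 ^+ 2 = coefG p / g,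
      - (X1.1 * X1.2) + X2.1 * X2.2 = - coefF p / g &
      - X1.2 ^+ 2 + X2.2 ^+ 2 = coefE p / g].
Proof.
move=> o g; have g0 : g != 0 := gram_neq0 o; move: o g0; rewrite /g {g}.
rewrite gramE => -[]; rewrite !metricE; move: (coefE p) (coefF p) (coefG p) => e f g.
case: X1 X2 => [a b] [c d] /= h1 h2 h3 g0.
pose k := a * d - b * c.
have kE : k ^+ 2 * e = - d ^+ 2 + b ^+ 2.
  move: (congr1 ( *%R (d ^+ 2)) h1) (congr1 ( *%R (b ^+ 2)) h2).
  by move: (congr1 ( *%R (b * d)) h3); rewrite /k; lra.
have kF : k ^+ 2 * f = c * d - a * b.
  move: (congr1 ( *%R (c * d)) h1) (congr1 ( *%R (a * b)) h2).
  by move: (congr1 ( *%R (a * d + b * c)) h3); rewrite /k; lra.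
have kG : k ^+ 2 * g = - c ^+ 2 + a ^+ 2.
  move: (congr1 ( *%R (c ^+ 2)) h1) (congr1 ( *%R (a ^+ 2)) h2).
  by move: (congr1 ( *%R (a * c)) h3); rewrite /k; lra.
have kg : k ^+ 2 * (e * g - f ^+ 2) = -1.
  rewrite [RHS](_ : -1 = (-1) * 1 - 0 ^+ 2 :> R); last by ring.
  by rewrite -[in RHS]h3 -[in RHS]h1 -[in RHS]h2 /k; ring.
have k0 : k ^+ 2 != 0.
  by apply/eqP => k0; move/eqP: kg; rewrite k0 mul0r eq_sym oppr_eq0 oner_eq0.
have kV u : u / (e * g - f ^+ 2) = - (k ^+ 2 * u).
  apply: (mulIf g0); rewrite divfK //.
  by rewrite mulNr mulrAC kg; ring.
by rewrite !kV mulrN kE kF kG; split; ring.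
Qed.

Lemma mean_curvatureE p H :
  pderivable (du x) p -> pderivable (dv x) p ->
  is_mean_curvature p H ->
  let N := orth_part (du x p) (dv x p) in
  H = (2 * gram (du x p) (dv x p))^-1 *:
    (coefG p *: N (du (du x) p) - coefF p *: (N (du (dv x) p) + N (dv (du x) p))
     + coefE p *: N (dv (dv x) p)).
Proof.
move=> [xu xu'] [xv xv'] [X1 [X2 [ho ->]]] N.
have hD (e X : R * R) : derivable (du x) p e -> derivable (dv x) p e ->
    'D_e (fun q => tvec q X) p
    = X.1 *: 'D_e (du x) p + X.2 *: 'D_e (dv x) p.
  exact: derive_lincomb.
have hs X : second_form (cst X) (cst X) p = X.1 ^+ 2 *: N (du (du x) p)
    + (X.1 * X.2) *: (N (du (dv x) p) + N (dv (du x) p))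
    + X.2 ^+ 2 *: N (dv (dv x) p).
  have hu : du (fun q => tvec q X) p = X.1 *: du (du x) p + X.2 *: du (dv x) p.
    exact: hD.
  have hv : dv (fun q => tvec q X) p = X.1 *: dv (du x) p + X.2 *: dv (dv x) p.
    exact: hD.
  have h : nabla (cst X) (cst X) p = X.1 *: (X.1 *: du (du x) p + X.2 *: du (dv x) p)
      + X.2 *: (X.1 *: dv (du x) p + X.2 *: dv (dv x) p).
    exact: (congr2 (fun y z => X.1 *: y + X.2 *: z) hu hv).
  exact: (etrans (congr1 N h) (orth_part_quad _ _ _ _ _ _ _ _)).
have fin (v1 v2 v3 : 'rV[R]_n) g e f k :
    [/\ - X1.1 ^+ 2 + X2.1 ^+ 2 = k / g,
      - (X1.1 * X1.2) + X2.1 * X2.2 = - f / g &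
      - X1.2 ^+ 2 + X2.2 ^+ 2 = e / g] ->
    2^-1 *: (- (X1.1 ^+ 2 *: v1 + (X1.1 * X1.2) *: v2 + X1.2 ^+ 2 *: v3)
      + (X2.1 ^+ 2 *: v1 + (X2.1 * X2.2) *: v2 + X2.2 ^+ 2 *: v3)) =
    (2 * g)^-1 *: (k *: v1 - f *: v2 + e *: v3).
  case=> h1 h2 h3; transitivity (2^-1 *: ((- X1.1 ^+ 2 + X2.1 ^+ 2) *: v1
      + (- (X1.1 * X1.2) + X2.1 * X2.2) *: v2 + (- X1.2 ^+ 2 + X2.2 ^+ 2) *: v3)).
    by apply/rowP => i; rewrite !mxE; ring.
  by rewrite h1 h2 h3 invfM; apply/rowP => i; rewrite !mxE; ring.
have h := congr2 (fun y z : 'rV[R]_n => 2^-1 *: (- y + z)) (hs X1) (hs X2).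
exact: (etrans h (fin _ _ _ _ _ _ _ (orthonormal_inv ho))).
Qed.

Lemma mean_curvature_unique p H1 H2 :
  pderivable (du x) p -> pderivable (dv x) p ->
  is_mean_curvature p H1 -> is_mean_curvature p H2 -> H1 = H2.
Proof.
by move=> du1 dv1 /(mean_curvatureE du1 dv1) -> /(mean_curvatureE du1 dv1) ->.
Qed.

Lemma mean_curvature_exists p :
  (exists X, metric p X X < 0) -> (exists Y, 0 < metric p Y Y) ->
  exists H, is_mean_curvature p H.
Proof.
move=> [[a b] +] [[c d] +].
rewrite !metricE /=; set e := coefE p; set f := coefF p; set g := coefG p.
set A := (X in X < 0) => A0; set C := (X in 0 < X) => C0.
pose B := a * c * e + (a * d + b * c) * f + b * d * g.
pose s := Num.sqrt (- A); pose C' := C - B ^+ 2 / A; pose t := Num.sqrt C'.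
have sA : s ^+ 2 = - A by rewrite sqr_sqrtr // oppr_ge0 ltW.
have C'0 : 0 < C'.
  by rewrite subr_gt0 (le_lt_trans _ C0) // mulr_ge0_le0 ?sqr_ge0 // invr_le0 ltW.
have tC : t ^+ 2 = C' by rewrite sqr_sqrtr // ltW.
have An0 : A != 0 by rewrite lt_eqF.
have s0 : s != 0 by rewrite sqrtr_eq0 -ltNge oppr_gt0.
have t0 : t != 0 by rewrite sqrtr_eq0 -ltNge.
pose X1 := (a / s, b / s).
pose X2 := ((c - B / A * a) / t, (d - B / A * b) / t).
eexists; exists X1, X2; split; last by [].
split; rewrite metricE -/e -/f -/g /=.
- rewrite (_ : _ + _ = A / s ^+ 2); last by rewrite /A; field.
  by rewrite sA invrN mulrN divff.
- rewrite (_ : _ + _ = C' / t ^+ 2); first by rewrite tC divff // gt_eqF.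
  transitivity ((C - 2 * (B / A) * B + (B / A) ^+ 2 * A) / t ^+ 2).
    by move: (B / A) => k; rewrite /C /A /B; field.
  congr (_ / _); rewrite /C'.
  have schur (k y z : R) : k != 0 ->
      z - 2 * (y / k) * y + (y / k) ^+ 2 * k = z - y ^+ 2 / k by move=> k0; field.
  exact: schur.
- rewrite (_ : _ + _ = (B - (B / A) * A) / (s * t)).
    by rewrite divfK // subrr mul0r.
  by move: (B / A) => k; rewrite /B /A; field; rewrite s0 t0.
Qed.

Definition minimal (D : set (R * R)) : Prop :=
  forall p, D p -> is_mean_curvature p 0.

End Surface.
End Calculus.

(* Main.v *)
Require Import Defs.
From mathcomp Require Import all_boot all_order all_algebra.
From mathcomp Require Import all_classical all_reals all_analysis.
From mathcomp Require Import ring lra.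
Set Implicit Arguments.
Unset Strict Implicit.
Unset Printing Implicit Defensive.
Import Order.TTheory GRing.Theory Num.Theory.
Import numFieldNormedType.Exports.
Local Open Scope classical_set_scope.
Local Open Scope ring_scope.

(* With x_u^2 = - x_v^2 and x_u . x_v = 0, differentiating shows that x_uu - x_vv is
   normal to the surface, and H is a nonzero multiple of its normal part: minimality
   is the wave equation x_uu = x_vv.  Writing Psi = x + j y, holomorphy of Psi means
   y_u = x_v and y_v = x_u; then Psi' = x_u + j x_v, and the two conditions on Psi'
   say exactly that (u, v) is isothermal with E < 0.  By the wave equation
   x_u + x_v depends only on u + v and x_u - x_v only on u - v, so the conjugate y
   is obtained without integration: y(q) = x(q1) - x(q2), where q1 and q2 are the
   projections of q along null directions on the two null lines through the base
   point.  Conversely the wave equation for x = Re Psi is y_vu = y_uv. *)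

Lemma is_derive_affine (R : realType) (V V' W : normedModType R)
    (f : V' -> W) (P : V -> V')
    (q e : V) (e' : V') (d : W) :
  (forall h : R, P (h *: e + q) = h *: e' + P q) ->
  is_derive (P q) e' f d -> is_derive q e (f \o P) d.
Proof.
move=> Pe [df dE].
have E : (fun h : R => h^-1 *: (((f \o P) \o shift q) (h *: e) - (f \o P) q))
    = (fun h : R => h^-1 *: ((f \o shift (P q)) (h *: e') - f (P q))).
  by apply/funext => h /=; rewrite Pe.
by apply: DeriveDef; rewrite /derivable /derive E.
Qed.

Section Directional.
Variables (R : realType) (V : normedModType R).
Implicit Types (a b p v : V) (f : V -> R).

Lemma is_derive_line f a v (t : R) : derivable f (t *: v + a) v ->
  is_derive t (1 : R) (fun h : R => f (h *: v + a)) ('D_v f (t *: v + a)).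
Proof.
move=> df; apply: (@is_derive_affine R R V R f (fun h : R => h *: v + a)).
  by move=> h /=; rewrite [h *: 1]mulr1 scalerDl addrA.
exact: derivableP.
Qed.

Lemma MVT_from0 (g dg : R -> R) (h : R) :
  (forall t : R, `|t| <= `|h| -> is_derive t 1 g (dg t)) ->
  exists2 t : R, `|t| <= `|h| & g h - g 0 = h * dg t.
Proof.
move=> dgt.
have cont (i : interval R) : (forall t : R, t \in i -> `|t| <= `|h|) ->
    {within [set` i], continuous g}.
  by move=> ih; apply: derivable_within_continuous => t /ih /dgt [].
have [h0|h0] := leP 0 h.
  have ih t : t \in `[0, h]%R -> `|t| <= `|h|.
    by rewrite in_itv /= => /andP[t0 th]; rewrite !ger0_norm.
  have ih' t : t \in `]0, h[%R -> `|t| <= `|h|.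
    by move=> /subset_itv_oo_cc; exact: ih.
  have [t /ih th ->] := MVT_segment h0 (fun t ht => dgt t (ih' t ht)) (cont _ ih).
  by exists t => //; rewrite subr0 mulrC.
have ih t : t \in `[h, 0]%R -> `|t| <= `|h|.
  by rewrite in_itv /= => /andP[t0 th]; rewrite !ler0_norm ?lerN2 // ltW.
have ih' t : t \in `]h, 0[%R -> `|t| <= `|h|.
  by move=> /subset_itv_oo_cc; exact: ih.
have [t /ih th e] := MVT_segment (ltW h0) (fun t ht => dgt t (ih' t ht)) (cont _ ih).
by exists t => //; rewrite -opprB e sub0r mulrN opprK mulrC.
Qed.

Lemma MVT_line f a v (h : R) :
  (forall t : R, `|t| <= `|h| -> derivable f (t *: v + a) v) ->
  exists2 t : R, `|t| <= `|h| & f (h *: v + a) - f a = h * 'D_v f (t *: v + a).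
Proof.
move=> df; have [t th e] := MVT_from0 (fun t ht => is_derive_line (df t ht)).
by exists t => //; rewrite -e scale0r add0r.
Qed.

Lemma is_derive_comb f p a b (s t : R) :
  (\forall q \near p, derivable f q a) -> (\forall q \near p, derivable f q b) ->
  {for p, continuous ('D_a f)} -> {for p, continuous ('D_b f)} ->
  is_derive p (s *: a + t *: b) f (s * 'D_a f p + t * 'D_b f p).
Proof.
move=> da db ca cb.
suff cv : (fun h : R => h^-1 *: ((f \o shift p) (h *: (s *: a + t *: b)) - f p)) @ 0^'
    --> (s * 'D_a f p + t * 'D_b f p : R).
  by apply: DeriveDef; [apply/cvg_ex; eexists; exact: cv | exact: (cvg_lim _ cv)].
apply/cvgrPdist_le => /= e e0.
pose e1 := e / (`|s| + `|t| + 1).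
have st0 : 0 < `|s| + `|t| + 1 by rewrite ltr_wpDl // addr_ge0.
have e10 : 0 < e1 by rewrite divr_gt0.
have na : \forall q \near p, `|'D_a f p - 'D_a f q| <= e1.
  by move/cvgrPdist_le : ca; apply.
have nb : \forall q \near p, `|'D_b f p - 'D_b f q| <= e1.
  by move/cvgrPdist_le : cb; apply.
have [r /= r0 rN] := (nbhs_normP _ _).1 (filterI (filterI da db) (filterI na nb)).
pose c := `|s| * `|a| + `|t| * `|b| + 1.
have c0 : 0 < c by rewrite ltr_wpDl // addr_ge0 // mulr_ge0.
near=> h.
have h0 : h != 0 by near: h; exact: nbhs_dnbhs_neq.
have hr : `|h| < r / c.
  by near: h; apply: dnbhs0_lt; rewrite divr_gt0.
have hc : `|h| * (`|s| * `|a| + `|t| * `|b|) < r.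
  apply: (@le_lt_trans _ _ (`|h| * c)); last by rewrite -ltr_pdivlMr.
  by rewrite ler_wpM2l // lerDl.
have inb (k l : R) : `|k| <= `|h * s| -> `|l| <= `|h * t| ->
    [/\ derivable f (k *: a + (l *: b + p)) a, derivable f (k *: a + (l *: b + p)) b,
    `|'D_a f p - 'D_a f (k *: a + (l *: b + p))| <= e1 &
    `|'D_b f p - 'D_b f (k *: a + (l *: b + p))| <= e1].
  move=> kh lh; suff /rN[[? ?] [? ?]] : `|p - (k *: a + (l *: b + p))| < r by [].
  rewrite /= addrA distrC addrK.
  apply: le_lt_trans hc; rewrite mulrDr !mulrA -!normrM.
  apply: le_trans (ler_normD _ _) _; rewrite (normrZ k) (normrZ l).
  by apply: lerD; apply: ler_wpM2r.
have [k kh Ek] : exists2 k : R, `|k| <= `|h * s| &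
    f ((h * s) *: a + ((h * t) *: b + p)) - f ((h * t) *: b + p)
    = (h * s) * 'D_a f (k *: a + ((h * t) *: b + p)).
  by apply: MVT_line => k kh; have [] := inb _ _ kh (lexx _).
have [l lh El] : exists2 l : R, `|l| <= `|h * t| &
    f ((h * t) *: b + p) - f p = (h * t) * 'D_b f (l *: b + p).
  apply: MVT_line => l lh; have [] := inb 0 l _ lh; last by rewrite scale0r add0r.
  by rewrite normr0.
have [_ _ ineqa _] := inb _ _ kh (lexx _).
have [|_ _ _] := inb 0 l _ lh; first by rewrite normr0.
rewrite scale0r add0r => ineqb.
have -> : h *: (s *: a + t *: b) + p = (h * s) *: a + ((h * t) *: b + p).
  by rewrite scalerDr !scalerA addrA.
rewrite -[X in _ *: X](subrKA (f ((h * t) *: b + p))) Ek El.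
move: ineqa ineqb; set A := 'D_a f (_ + _); set B := 'D_b f (_ + _) => ineqa ineqb.
have alg (x y z w : R) : s * x + t * y - h^-1 * (h * s * z + h * t * w)
    = s * (x - z) + t * (y - w) by field.
rewrite [_ - _]alg.
apply: (@le_trans _ _ ((`|s| + `|t|) * e1)).
  rewrite mulrDl; apply: le_trans (ler_normD _ _) _; rewrite !normrM.
  by rewrite lerD // ler_wpM2l.
by rewrite /e1 mulrCA ger_pMr // ler_pdivrMr // mul1r lerDl.
Unshelve. all: by end_near. Qed.

Lemma double_increment f p a b (r h : R) :
  (forall q, `|q - p| < r -> derivable f q a /\ derivable ('D_a f) q b) ->
  0 < h -> h * (`|a| + `|b|) < r ->
  exists2 q, `|q - p| < r &
    f (h *: a + h *: b + p) - f (h *: b + p) - (f (h *: a + p) - f p)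
    = h * h * 'D_b ('D_a f) q.
Proof.
move=> df h0 hr.
have inb (k l : R) : `|k| <= `|h| -> `|l| <= `|h| ->
    `|(l *: b + (k *: a + p)) - p| < r.
  move=> kh lh; rewrite addrA addrK; apply: le_lt_trans hr.
  apply: le_trans (ler_normD _ _) _; rewrite (normrZ k) (normrZ l) mulrDr addrC.
  by rewrite -(gtr0_norm h0); apply: lerD; apply: ler_wpM2r.
have d1 (t : R) : `|t| <= `|h| -> derivable f (t *: a + (h *: b + p)) a.
  by move=> th; rewrite addrCA; exact: (df _ (inb _ _ th (lexx _))).1.
have d2 (t : R) : `|t| <= `|h| -> derivable f (t *: a + p) a.
  move=> th; have n0 : `|0 : R| <= `|h| by rewrite normr0.
  by have [+ _] := df _ (inb t 0 th n0); rewrite scale0r add0r; apply.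
pose g (t : R) := f (t *: a + (h *: b + p)) - f (t *: a + p).
have [t th] : exists2 t : R, `|t| <= `|h| & g h - g 0 = h *
    ('D_a f (t *: a + (h *: b + p)) - 'D_a f (t *: a + p)).
  apply: MVT_from0 => t th.
  exact: (is_deriveB (is_derive_line (d1 t th)) (is_derive_line (d2 t th))).
have [l lh El] : exists2 l : R, `|l| <= `|h| &
    'D_a f (h *: b + (t *: a + p)) - 'D_a f (t *: a + p)
    = h * 'D_b ('D_a f) (l *: b + (t *: a + p)).
  apply: (MVT_line (f := 'D_a f)) => l lh; exact: (df _ (inb _ _ th lh)).2.
rewrite [t *: a + (_ + _)]addrCA El mulrA => Eg.
exists (l *: b + (t *: a + p)); first exact: inb.
rewrite -Eg /g !scale0r !add0r -(addrA (h *: a)).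
have alg (x y z w : R) : x - y - (z - w) = x - z - (y - w) by ring.
exact: alg.
Qed.

Lemma derive_comm f p a b :
  (\forall q \near p, derivable f q a /\ derivable ('D_a f) q b) ->
  (\forall q \near p, derivable f q b /\ derivable ('D_b f) q a) ->
  {for p, continuous ('D_b ('D_a f))} -> {for p, continuous ('D_a ('D_b f))} ->
  'D_b ('D_a f) p = 'D_a ('D_b f) p.
Proof.
move=> da db ca cb; apply/eqP; rewrite -subr_eq0 -normr_eq0 eq_le normr_ge0 andbT.
apply/ler_addgt0Pr => e e0; rewrite add0r.
have e20 : 0 < e / 2 by rewrite divr_gt0.
have na : \forall q \near p, `|'D_b ('D_a f) p - 'D_b ('D_a f) q| <= e / 2.
  by move/cvgrPdist_le : ca; apply.
have nb : \forall q \near p, `|'D_a ('D_b f) p - 'D_a ('D_b f) q| <= e / 2.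
  by move/cvgrPdist_le : cb; apply.
have [r /= r0 rN] := (nbhs_normP _ _).1 (filterI (filterI da db) (filterI na nb)).
have c0 : 0 < `|a| + `|b| + 1 by rewrite ltr_wpDl // addr_ge0.
pose h := r / (`|a| + `|b| + 1).
have h0 : 0 < h by rewrite divr_gt0.
have hr : h * (`|a| + `|b|) < r.
  by rewrite /h mulrAC ltr_pdivrMr // ltr_pM2l // ltrDl.
have [q1 q1r E1] : exists2 q, `|q - p| < r &
    f (h *: a + h *: b + p) - f (h *: b + p) - (f (h *: a + p) - f p)
    = h * h * 'D_b ('D_a f) q.
  refine (double_increment _ h0 hr) => q qr.
  by have [|[+ _] _] := rN q; rewrite /= 1?distrC.
have [q2 q2r E2] : exists2 q, `|q - p| < r &
    f (h *: b + h *: a + p) - f (h *: a + p) - (f (h *: b + p) - f p)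
    = h * h * 'D_a ('D_b f) q.
  rewrite [X in _ * X]addrC in hr.
  refine (double_increment _ h0 hr) => q qr.
  by have [|[_ +] _] := rN q; rewrite /= 1?distrC.
have E : 'D_b ('D_a f) q1 = 'D_a ('D_b f) q2.
  apply: (@mulfI _ (h * h)); first by rewrite mulf_neq0 // gt_eqF.
  have alg (x y z w : R) : x - y - (z - w) = x - z - (y - w) by ring.
  move: E2; rewrite (addrC (h *: b) (h *: a)) => E2.
  exact: etrans (esym E1) (etrans (alg _ _ _ _) E2).
have [|_ [i1 _]] := rN q1; first by rewrite /= distrC.
have [|_ [_ i2]] := rN q2; first by rewrite /= distrC.
rewrite -(subrKA ('D_b ('D_a f) q1)) (splitr e).
apply: le_trans (ler_normD _ _) _; apply: lerD; first exact: i1.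
by rewrite E distrC; exact: i2.
Qed.

End Directional.

Section Planar.
Variable R : realType.
Implicit Types (D U : set (R * R)) (p q : R * R).

Lemma Ck_subset (V : normedModType R) k U D (f : R * R -> V) :
  U `<=` D -> Ck k D f -> Ck k U f.
Proof.
move=> UD; elim: k f => [|k IH] f /=.
  by move=> [fc _]; split=> // q /UD; exact: fc.
move=> [fc [fd fu fv]]; split; first by move=> q /UD; exact: fc.
by split; [move=> q /UD; exact: fd | exact: IH | exact: IH].
Qed.

Lemma open_near_eq (V : normedModType R) D (f g : R * R -> V) :
  open D -> (forall q, D q -> f q = g q) ->
  forall q, D q -> {near q, f =1 g}.
Proof. by move=> oD fg q Dq; apply: filterS (open_nbhs_nbhs (conj oD Dq)); exact: fg. Qed.

Lemma du_ext (V : normedModType R) D (f g : R * R -> V) :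
  open D -> (forall q, D q -> f q = g q) -> forall q, D q -> du f q = du g q.
Proof. by move=> oD fg q Dq; exact: near_eq_derive (open_near_eq oD fg Dq). Qed.

Lemma dv_ext (V : normedModType R) D (f g : R * R -> V) :
  open D -> (forall q, D q -> f q = g q) -> forall q, D q -> dv f q = dv g q.
Proof. by move=> oD fg q Dq; exact: near_eq_derive (open_near_eq oD fg Dq). Qed.

Lemma Ck_ext (V : normedModType R) k D (f g : R * R -> V) :
  open D -> (forall q, D q -> f q = g q) -> Ck k D f -> Ck k D g.
Proof.
move=> oD; elim: k f g => [|k IH] f g fg /=.
  move=> [fc _]; split=> // q Dq; rewrite /prop_for /continuous_at -(fg q Dq).
  exact: cvg_trans (near_eq_cvg (open_near_eq oD fg Dq)) (fc q Dq).
move=> [fc [fd fu fv]]; split.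
  move=> q Dq; rewrite /prop_for /continuous_at -(fg q Dq).
  exact: cvg_trans (near_eq_cvg (open_near_eq oD fg Dq)) (fc q Dq).
split.
- move=> q Dq; have [f1 f2] := fd q Dq.
  by split; exact: near_eq_derivable (open_near_eq oD fg Dq) _.
- exact: IH (du_ext oD fg) fu.
- exact: IH (dv_ext oD fg) fv.
Qed.

Lemma du_coord n (f : R * R -> 'rV[R]_n) (i : 'I_n) q : pderivable f q ->
  du f q 0 i = du (fun q => f q 0 i) q.
Proof. by move=> [fu _]; rewrite /du (derive_mx fu) mxE. Qed.

Lemma dv_coord n (f : R * R -> 'rV[R]_n) (i : 'I_n) q : pderivable f q ->
  dv f q 0 i = dv (fun q => f q 0 i) q.
Proof. by move=> [_ fv]; rewrite /dv (derive_mx fv) mxE. Qed.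

Lemma Ck_coord n k D (f : R * R -> 'rV[R]_n) (i : 'I_n) :
  open D -> Ck k D f -> Ck k D (fun q => f q 0 i).
Proof.
move=> oD; elim: k f => [|k IH] f /=.
  move=> [fc _]; split=> // q Dq.
  exact: (continuous_comp (fc q Dq) (@coord_continuous _ _ _ _ _ _)).
move=> [fc [fd fu fv]]; split.
  move=> q Dq; exact: (continuous_comp (fc q Dq) (@coord_continuous _ _ _ _ _ _)).
split.
- by move=> q Dq; have [/derivable_mxP f1 /derivable_mxP f2] := fd q Dq; split.
- exact: Ck_ext oD (fun q Dq => du_coord i (fd q Dq)) (IH _ fu).
- exact: Ck_ext oD (fun q Dq => dv_coord i (fd q Dq)) (IH _ fv).
Qed.

Lemma du_dv_comm n D (f : R * R -> 'rV[R]_n) : open D -> Ck 2 D f ->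
  forall p, D p -> du (dv f) p = dv (du f) p.
Proof.
move=> oD f2 p Dp; apply/rowP => i.
have [_ [fd [_ [fud _ _]] [_ [fvd _ _]]]] := f2.
refine (etrans (du_coord i (fvd p Dp)) (etrans _ (esym (dv_coord i (fud p Dp))))).
refine (etrans (du_ext oD (fun q Dq => dv_coord i (fd q Dq)) Dp) (etrans _
  (esym (dv_ext oD (fun q Dq => du_coord i (fd q Dq)) Dp)))).
have [_ [gd [_ [gud _ [guvc _]]] [_ [gvd [gvuc _] _]]]] := Ck_coord i oD f2.
have nD := open_nbhs_nbhs (conj oD Dp).
apply: derive_comm; [| |exact: gvuc|exact: guvc].
- by apply: filterS nD => q Dq; exact: conj (gd q Dq).2 (gvd q Dq).1.
- by apply: filterS nD => q Dq; exact: conj (gd q Dq).1 (gud q Dq).2.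
Qed.

Lemma is_derive_rV (V : normedModType R) n (f : V -> 'rV[R]_n) (q e : V) (d : 'rV[R]_n) :
  (forall i, is_derive q e (fun r => f r 0 i) (d 0 i)) -> is_derive q e f d.
Proof.
move=> fd; have df : derivable f q e.
  by apply/derivable_mxP => i j; rewrite (ord1 i); case: (fd j).
apply: DeriveDef => //; rewrite (derive_mx df); apply/rowP => i; rewrite mxE.
by case: (fd i).
Qed.

Lemma is_derive_coord (V : normedModType R) n (f : V -> 'rV[R]_n) (q e : V)
    (d : 'rV[R]_n) (i : 'I_n) :
  is_derive q e f d -> is_derive q e (fun r => f r 0 i) (d 0 i).
Proof.
move=> [df <-]; apply: DeriveDef; first by move/derivable_mxP: df; apply.
by rewrite (derive_mx df) mxE.
Qed.

Lemma is_derive_C1 n D (f : R * R -> 'rV[R]_n) (s t : R) p :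
  open D -> Ck 1 D f -> D p ->
  is_derive p ((s, t) : R * R) f (s *: du f p + t *: dv f p).
Proof.
move=> oD f1 Dp; have [_ [fd _ _]] := f1; refine (is_derive_rV _) => i.
have comb (a b : 'rV[R]_n) : (s *: a + t *: b) 0 i = s * a 0 i + t * b 0 i.
  by rewrite !mxE.
rewrite (etrans (comb _ _) (congr2 (fun y z => s * y + t * z)
  (du_coord i (fd p Dp)) (dv_coord i (fd p Dp)))).
have [_ [gd [guc _] [gvc _]]] := Ck_coord i oD f1.
have nD := open_nbhs_nbhs (conj oD Dp).
have -> : (s, t) = s *: ((1, 0) : R * R) + t *: ((0, 1) : R * R).
  by congr pair; rewrite /= /GRing.scale /=; ring.
apply: is_derive_comb; [| |exact: guc|exact: gvc].
- by apply: filterS nD => q Dq; exact: (gd q Dq).1.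
- by apply: filterS nD => q Dq; exact: (gd q Dq).2.
Qed.

Lemma derive0_line (V : normedModType R) n (f : V -> 'rV[R]_n) (a v : V) (h : R) :
  (forall t : R, `|t| <= `|h| -> is_derive (t *: v + a) v f 0) ->
  f (h *: v + a) = f a.
Proof.
move=> f0; apply/rowP => i; apply/eqP; rewrite -subr_eq0; apply/eqP.
have g0 t : `|t| <= `|h| -> is_derive (t *: v + a) v (fun r => f r 0 i) 0.
  by move=> /f0 /(is_derive_coord i); rewrite mxE.
have [|t th ->] := @MVT_line R V (fun r => f r 0 i) a v h.
  by move=> t /g0 [].
by have [_ ->] := g0 t th; rewrite mulr0.
Qed.

Lemma is_derive_mdot (V : normedModType R) n (f g : V -> 'rV[R]_n) (q e : V)
    (df dg : 'rV[R]_n) :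
  is_derive q e f df -> is_derive q e g dg ->
  is_derive q e (fun r => mdot (f r) (g r)) (mdot df (g q) + mdot (f q) dg).
Proof.
move=> fd gd; rewrite /mdot -big_split /=.
have -> : (fun r => \sum_(i < n) (-1) ^+ (i == 0 :> nat) * (f r 0 i * g r 0 i))
   = \sum_(i < n) ((-1) ^+ (i == 0 :> nat) *: ((fun r => f r 0 i) * (fun r => g r 0 i))).
  by apply/funext => z; rewrite fct_sumE.
apply: is_derive_sum => i.
apply: (is_derive_eq (is_deriveZ ((-1) ^+ (i == 0 :> nat))
  (is_deriveM (is_derive_coord i fd) (is_derive_coord i gd)))).
by rewrite /GRing.scale /=; ring.
Qed.

Lemma connected_ball p (r : R) : 0 < r -> connected (ball p r).
Proof.
move=> r0.
pose A q := (fun t : R => t *: (q - p) + p) @` `[0, 1].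
have -> : ball p r = \bigcup_(q in ball p r) A q.
  apply/seteqP; split=> [q pq|q [q' pq' [t /= t01 <-]]].
    by exists q => //; exists 1; rewrite /= ?in_itv /= ?lexx ?ler01 // scale1r subrK.
  move: t01 pq'; rewrite in_itv /= => /andP[t0 t1].
  rewrite -ball_normE /= => pq'; rewrite opprD addrCA subrr addr0 normrN normrZ.
  rewrite ger0_norm // distrC (le_lt_trans _ pq') //.
  by rewrite ler_piMl.
apply: bigcup_connected => [|q _].
  exists p => q _; exists 0; rewrite /= ?scale0r ?add0r // in_itv /= lexx ler01 //.
apply: connected_continuous_connected; first exact: segment_connected.
apply: continuous_subspaceT => t.
by apply: cvgD; [apply: cvgZr_tmp; exact: cvg_id | exact: cvg_cst].
Qed.

End Planar.

Lemma is_derive_near_unique (R : realType) (V W : normedModType R) (f g : V -> W)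
    (p e : V) (df dg : W) : is_derive p e f df -> is_derive p e g dg ->
  {near p, f =1 g} -> df = dg.
Proof. by move=> [_ <-] [_ <-]; exact: near_eq_derive. Qed.

Section DoubleRows.
Variables (R : realType) (n : nat).
Implicit Types a b c d : 'rV[R]_n.

Lemma rowRe_rowD a b : rowRe (rowD a b) = a.
Proof. by apply/rowP => i; rewrite !mxE. Qed.

Lemma rowIm_rowD a b : rowIm (rowD a b) = b.
Proof. by apply/rowP => i; rewrite !mxE. Qed.

Lemma Dbar_rowD a b c d :
  Dreal 2^-1 *: (rowD a b - Dj *: rowD c d) = 0 <-> a = d /\ c = b.
Proof.
split=> [/rowP h|[-> ->]].
  split; apply/rowP => i; have := h i; rewrite !mxE => -[/= h1 h2]; lra.
by apply/rowP => i; rewrite !mxE; congr Double => /=; ring.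
Qed.

Lemma D_rowD a b c d : a = d -> c = b ->
  Dreal 2^-1 *: (rowD a b + Dj *: rowD c d) = rowD a c.
Proof. by move=> -> ->; apply/rowP => i; rewrite !mxE; congr Double => /=; field. Qed.

Lemma Dsq_rowD a b :
  Dsq (rowD a b) = Double (mdot a a + mdot b b) (2 * mdot a b).
Proof.
rewrite /Dsq /mdot mulr_sumr -big_split /=.
apply: (big_rec3 (fun x y z => z = Double x y)) => // i y1 y2 y3 _ ->.
rewrite !mxE; case: (_ == _); rewrite ?expr0 ?expr1; congr Double => /=; ring.
Qed.

Lemma Dnormsq_rowD a b : Dnormsq (rowD a b) = mdot a a - mdot b b.
Proof.
rewrite /Dnormsq /mdot -sumrB.
apply: (big_rec2 (fun x y => Dre x = y)) => //= i y x _ ->.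
by rewrite !mxE; case: (_ == _); rewrite ?expr0 ?expr1 /=; ring.
Qed.

Lemma null_rowD a b :
  [/\ mdot a a = - mdot b b, mdot a b = 0 & mdot a a < 0] <->
  Dsq (rowD a b) = 0 /\ Dnormsq (rowD a b) < 0.
Proof.
rewrite Dsq_rowD Dnormsq_rowD.
move: (mdot a a) (mdot a b) (mdot b b) => e f g.
split=> [[h1 h2 h3]|[[h1 h2] h3]].
  by split; [congr Double; lra | lra].
by split; lra.
Qed.

End DoubleRows.

Section Holomorphic.
Variables (R : realType) (n : nat).
Implicit Types (Psi : dnum R -> 'rV[dnum R]_n) (p : R * R).

Lemma Ddbar_eq0 Psi p : Ddbar Psi p = 0 <->
  du (fun q => rowRe (Psi (dnum_of_pair q))) p
    = dv (fun q => rowIm (Psi (dnum_of_pair q))) p /\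
  dv (fun q => rowRe (Psi (dnum_of_pair q))) p
    = du (fun q => rowIm (Psi (dnum_of_pair q))) p.
Proof. exact: Dbar_rowD. Qed.

Lemma Dd_holomorphic Psi p : Ddbar Psi p = 0 ->
  Dd Psi p = rowD (du (fun q => rowRe (Psi (dnum_of_pair q))) p)
                  (dv (fun q => rowRe (Psi (dnum_of_pair q))) p).
Proof. move=> /Ddbar_eq0[e1 e2]; exact: D_rowD e1 e2. Qed.

End Holomorphic.

Lemma normal_part_wave (R : realType) n (a b uu uv vu vv : 'rV[R]_n) :
  mdot a a = - mdot b b -> mdot a b = 0 -> mdot a a < 0 -> uv = vu ->
  mdot uu a + mdot a uu = - (mdot uv b + mdot b uv) ->
  mdot vu a + mdot a vu = - (mdot vv b + mdot b vv) ->
  mdot uu b + mdot a uv = 0 -> mdot vu b + mdot a vv = 0 ->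
  0 = (2 * gram a b)^-1 *: (mdot b b *: orth_part a b uu
    - mdot a b *: (orth_part a b uv + orth_part a b vu)
    + mdot a a *: orth_part a b vv) ->
  uu = vv.
Proof.
move=> E F E0 S Eu Ev Fu Fv H; subst vu.
have w1 : mdot (uu - vv) a = 0.
  rewrite -scaleN1r !(mdotDl, mdotZl).
  by move: Eu Fv; rewrite (mdotC a uu) (mdotC b uv) (mdotC vv a); lra.
have w2 : mdot (uu - vv) b = 0.
  rewrite -scaleN1r !(mdotDl, mdotZl).
  by move: Ev Fu; rewrite (mdotC a uv) (mdotC b vv); lra.
have N : orth_part a b (uu - vv) = uu - vv.
  by rewrite /orth_part w1 w2 !mulr0 subrr !mul0r !scale0r addr0 subr0.
have b0 : mdot b b != 0.
  by apply/eqP => bb; move: E0; rewrite E bb oppr0 ltxx.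
have g0 : 2 * gram a b != 0.
  by rewrite /gram F E expr0n subr0 mulNr !(mulf_neq0, oppr_eq0) // pnatr_eq0.
move: H; rewrite F scale0r subr0 E => H.
have : mdot b b *: orth_part a b (uu - vv) = 0.
  apply: (scalerI (invr_neq0 g0)); rewrite scaler0 [RHS]H.
  by rewrite -scaleN1r orth_partD orth_partZ scalerDr scalerA mulrN1.
rewrite N => /eqP; rewrite scaler_eq0 (negPf b0) subr_eq0 => /eqP.
exact.
Qed.

Lemma wave_normal_part (R : realType) n (a b uu uv vu vv : 'rV[R]_n) :
  mdot a a = - mdot b b -> mdot a b = 0 -> uu = vv ->
  (2 * gram a b)^-1 *: (mdot b b *: orth_part a b uu
    - mdot a b *: (orth_part a b uv + orth_part a b vu)
    + mdot a a *: orth_part a b vv) = 0.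
Proof. by move=> E F ->; rewrite F scale0r subr0 E scaleNr subrr scaler0. Qed.

Section Isothermal.
Variables (R : realType) (n : nat) (x : R * R -> 'rV[R]_n).
Implicit Types (D : set (R * R)) (p : R * R).

Lemma isothermal_immersion p : coefF x p = 0 -> Defs.coefE x p != 0 ->
  coefG x p != 0 -> injective (tvec x p).
Proof.
rewrite /Defs.coefE /coefF /coefG => f0 e0 g0 [s t] [s' t'].
rewrite /tvec /=; move: (du x p) (dv x p) f0 e0 g0 => a b f0 e0 g0 h.
congr pair.
  move/(congr1 (fun c => mdot c a)): h.
  by rewrite !(mdotDl, mdotZl) (mdotC b a) f0 !mulr0 !addr0 => /(mulIf e0).
move/(congr1 (fun c => mdot c b)): h.
by rewrite !(mdotDl, mdotZl) f0 !mulr0 !add0r => /(mulIf g0).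
Qed.

Lemma isothermal_wave D : open D -> smooth D x -> isothermal x D ->
  minimal x D -> forall p, D p -> du (du x) p = dv (dv x) p.
Proof.
move=> oD sx iso min p Dp; have [E F E0] := iso p Dp.
have [_ [_ [_ [pu _ _]] [_ [pv _ _]]]] := sx 2%N.
have [/derivableP duu /derivableP dvu] := pu p Dp.
have [/derivableP duv /derivableP dvv] := pv p Dp.
have eqEG (q : R * R) : D q -> Defs.coefE x q = - coefG x q by move=> /iso[].
have eqF (q : R * R) : D q -> coefF x q = cst 0 q by move=> /iso[].
have nE : {near p, Defs.coefE x =1 - coefG x} := open_near_eq oD eqEG Dp.
have nF : {near p, coefF x =1 cst 0} := open_near_eq oD eqF Dp.
have Eu : mdot (du (du x) p) (du x p) + mdot (du x p) (du (du x) p)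
    = - (mdot (du (dv x) p) (dv x p) + mdot (dv x p) (du (dv x) p)).
  exact: is_derive_near_unique (is_derive_mdot duu duu)
    (is_deriveN (is_derive_mdot duv duv)) nE.
have Ev : mdot (dv (du x) p) (du x p) + mdot (du x p) (dv (du x) p)
    = - (mdot (dv (dv x) p) (dv x p) + mdot (dv x p) (dv (dv x) p)).
  exact: is_derive_near_unique (is_derive_mdot dvu dvu)
    (is_deriveN (is_derive_mdot dvv dvv)) nE.
have Fu : mdot (du (du x) p) (dv x p) + mdot (du x p) (du (dv x) p) = 0.
  exact: is_derive_near_unique (is_derive_mdot duu duv) (is_derive_cst _ _ _) nF.
have Fv : mdot (dv (du x) p) (dv x p) + mdot (du x p) (dv (dv x) p) = 0.
  exact: is_derive_near_unique (is_derive_mdot dvu dvv) (is_derive_cst _ _ _) nF.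
exact: normal_part_wave E F E0 (du_dv_comm oD (sx 2%N) Dp) Eu Ev Fu Fv
  (mean_curvatureE (pu p Dp) (pv p Dp) (min p Dp)).
Qed.

Lemma wave_minimal D : smooth D x -> timelike_surface x D -> isothermal x D ->
  (forall p, D p -> du (du x) p = dv (dv x) p) -> minimal x D.
Proof.
move=> sx [_ _ _ tl] iso wave p Dp; have [h1 h2] := tl p Dp.
have [E F _] := iso p Dp.
have [_ [_ [_ [pu _ _]] [_ [pv _ _]]]] := sx 2%N.
have [H Hmc] := mean_curvature_exists h1 h2.
suff H0 : H = 0 by rewrite -H0.
exact: etrans (mean_curvatureE (pu p Dp) (pv p Dp) Hmc)
  (wave_normal_part _ _ E F (wave p Dp)).
Qed.

End Isothermal.

Lemma normr_sqr1 (R : realDomainType) (s : R) : s * s = 1 -> `|s| = 1.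
Proof.
by move=> ss; apply/eqP; rewrite -(@eqrXn2 _ 2) // ?expr1n expr2 -normrM ss normr1.
Qed.

Section Conjugate.
Variable R : realType.
Implicit Types (D : set (R * R)) (p q : R * R).

Lemma ball_pairE p (r : R) q :
  ball p r q <-> `|p.1 - q.1| < r /\ `|p.2 - q.2| < r.
Proof. by []. Qed.

(* For s = 1 or -1, the point of the null line through p of direction (1, s)
   having the same coordinate u + s v as q. *)
Definition null_proj (s : R) p q : R * R :=
  ((q.1 + s * q.2 + (p.1 - s * p.2)) / 2, (q.2 + s * q.1 + (p.2 - s * p.1)) / 2).

Lemma ball_null_proj (s : R) p r q : s * s = 1 ->
  ball p r q -> ball p r (null_proj s p q).
Proof.
move=> ss /ball_pairE[h1 h2]; have s1 := normr_sqr1 ss.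
have h (y z : R) : `|y| < r -> `|z| < r -> `|(y + s * z) / 2| < r.
  move=> yr zr; rewrite normrM normfV (ger0_norm (ler0n _ 2)) ltr_pdivrMr //.
  apply: le_lt_trans (ler_normD _ _) _; rewrite normrM s1 mul1r mulr_natr mulr2n.
  exact: ltrD.
apply/ball_pairE; split=> /=.
  have -> : p.1 - (q.1 + s * q.2 + (p.1 - s * p.2)) / 2
    = ((p.1 - q.1) + s * (p.2 - q.2)) / 2 by field.
  exact: h.
have -> : p.2 - (q.2 + s * q.1 + (p.2 - s * p.1)) / 2
  = ((p.2 - q.2) + s * (p.1 - q.1)) / 2 by field.
exact: h.
Qed.

Lemma null_projD (s h : R) p q (e : R * R) :
  null_proj s p (h *: e + q) =
  h *: ((e.1 + s * e.2) / 2, (e.2 + s * e.1) / 2) + null_proj s p q.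
Proof.
by case: e => e1 e2; congr pair; rewrite /= /GRing.scale /=; field.
Qed.

Lemma continuous_null_proj (s : R) p : continuous (null_proj s p).
Proof.
move=> q.
have lin (f g : R * R -> R) (k : R) : {for q, continuous f} -> {for q, continuous g} ->
    (fun r => (f r + s * g r + k) / 2) @ q --> (f q + s * g q + k) / 2.
  move=> cf cg; apply: cvgM; last exact: cvg_cst.
  apply: cvgD; last exact: cvg_cst.
  by apply: cvgD; [exact: cf | apply: cvgM; [exact: cvg_cst | exact: cg]].
have c1 : {for q, continuous (@fst R R)} by exact: cvg_fst.
have c2 : {for q, continuous (@snd R R)} by exact: cvg_snd.
exact: (cvg_pair (lin _ _ _ c1 c2) (lin _ _ _ c2 c1)).
Qed.

Lemma null_proj_line (s : R) p q : s * s = 1 ->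
  null_proj s p q =
  ((s * (q.2 - p.2) - (q.1 - p.1)) / 2) *: ((1, - s) : R * R) + q.
Proof.
move=> ss; congr pair; rewrite /= /GRing.scale /=; first by field.
transitivity ((q.2 + s * q.1 + (p.2 - s * p.1)) / 2); first by [].
have -> : (s * (q.2 - p.2) - (q.1 - p.1)) / 2 * - s
  = (- (s * s) * (q.2 - p.2) + s * (q.1 - p.1)) / 2 by field.
by rewrite ss; field.
Qed.

Variables (n : nat) (D : set (R * R)) (x : R * R -> 'rV[R]_n).
Hypotheses (oD : open D) (sx : smooth D x).

Lemma is_derive_null_proj (s : R) p q (e : R * R) : D (null_proj s p q) ->
  is_derive q e (x \o null_proj s p)
    (((e.1 + s * e.2) / 2) *: du x (null_proj s p q)
     + ((e.2 + s * e.1) / 2) *: dv x (null_proj s p q)).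
Proof.
move=> Dq; refine (is_derive_affine (fun h => null_projD s h p q e) _).
exact: is_derive_C1 oD (sx 1%N) Dq.
Qed.

Hypothesis wave : forall q, D q -> du (du x) q = dv (dv x) q.

Lemma wave_derive_null (s : R) q : s * s = 1 -> D q ->
  is_derive q ((1, - s) : R * R) (fun r => du x r + s *: dv x r) 0.
Proof.
move=> ss Dq; have [_ [_ su sv]] := sx 2%N.
have d1 := is_derive_C1 1 (- s) oD su Dq.
have d2 := is_deriveZ s (is_derive_C1 1 (- s) oD sv Dq).
refine (is_derive_eq (is_deriveD d1 d2) _).
have alg (a b c d : 'rV[R]_n) : a = d -> c = b ->
    1 *: a + - s *: b + s *: (1 *: c + - s *: d) = 0.
  move=> -> ->; apply/rowP => i; rewrite !mxE.
  have -> : 1 * d 0 i + - s * b 0 i + s * (1 * b 0 i + - s * d 0 i)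
    = (1 - s * s) * d 0 i by ring.
  by rewrite ss subrr mul0r.
exact: alg (wave Dq) (du_dv_comm oD (sx 2%N) Dq).
Qed.

Lemma wave_null_proj (s : R) p r q : s * s = 1 -> ball p (r *+ 3) `<=` D ->
  ball p r q ->
  du x (null_proj s p q) + s *: dv x (null_proj s p q) = du x q + s *: dv x q.
Proof.
move=> ss bD pq; rewrite (null_proj_line p q ss); set h := _ / 2.
have [q1 q2] := (ball_pairE _ _ _).1 pq.
have s1 := normr_sqr1 ss.
have hr : `|h| < r.
  rewrite /h normrM normfV (ger0_norm (ler0n _ 2)) ltr_pdivrMr //.
  apply: le_lt_trans (ler_normB _ _) _; rewrite normrM s1 mul1r mulr_natr mulr2n.
  by rewrite distrC (distrC q.1); exact: ltrD.
refine (derive0_line (f := fun r => du x r + s *: dv x r) _) => t th.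
apply: wave_derive_null => //; apply: bD; have tr := le_lt_trans th hr.
have r0 : 0 < r := le_lt_trans (normr_ge0 _) hr.
have h' (y z : R) : `|y| < r -> `|z| < r -> `|y - z| < r *+ 3.
  move=> yr zr; apply: le_lt_trans (ler_normB _ _) _.
  by rewrite mulrS mulr2n addrA ltr_wpDr ?ltrD // ltW.
apply/ball_pairE; rewrite /= /GRing.scale /=; split.
  have -> : p.1 - (t * 1 + q.1) = (p.1 - q.1) - t by ring.
  exact: h'.
have -> : p.2 - (t * - s + q.2) = (p.2 - q.2) - (- s * t) by ring.
by apply: h' => //; rewrite normrM normrN s1 mul1r.
Qed.

Lemma wave_conjugate p : D p ->
  exists (U : set (R * R)) (y : R * R -> 'rV[R]_n),
    [/\ domain U, U `<=` D /\ U p, smooth U y &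
        forall q, U q -> du y q = dv x q /\ dv y q = du x q].
Proof.
move=> Dp; have [e /= e0 eD] := (nbhs_ballP _ _).1 (open_nbhs_nbhs (conj oD Dp)).
pose r := e / 3; have r0 : 0 < r by rewrite divr_gt0.
have rD : ball p (r *+ 3) `<=` D.
  by rewrite /r -mulr_natr divfK ?pnatr_eq0.
have UD : ball p r `<=` D.
  move=> q pq; apply: rD; apply: le_ball pq.
  by rewrite mulrS lerDl mulrn_wge0 // ltW.
have s1 : 1 * 1 = 1 :> R by rewrite mulr1.
have s2 : -1 * -1 = 1 :> R by rewrite mulrNN mulr1.
pose y q := x (null_proj 1 p q) - x (null_proj (-1) p q).
have dy q (d : R * R) : ball p r q ->
    is_derive q d y (d.2 *: du x q + d.1 *: dv x q).
  move=> pq; have P1 := ball_null_proj s1 pq; have P2 := ball_null_proj s2 pq.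
  have dd := is_deriveB (is_derive_null_proj d (UD _ P1))
    (is_derive_null_proj d (UD _ P2)).
  refine (is_derive_eq dd _).
  have alg (a b a1 b1 a2 b2 : 'rV[R]_n) :
      a1 + 1 *: b1 = a + 1 *: b -> a2 + (-1) *: b2 = a + (-1) *: b ->
      ((d.1 + 1 * d.2) / 2) *: a1 + ((d.2 + 1 * d.1) / 2) *: b1
      - (((d.1 + -1 * d.2) / 2) *: a2 + ((d.2 + -1 * d.1) / 2) *: b2)
      = d.2 *: a + d.1 *: b.
    move=> E1 E2.
    transitivity (((d.1 + d.2) / 2) *: (a1 + 1 *: b1)
      - ((d.1 - d.2) / 2) *: (a2 + (-1) *: b2)).
      by apply/rowP => i; rewrite !mxE; field.
    by rewrite E1 E2; apply/rowP => i; rewrite !mxE; field.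
  exact: alg (wave_null_proj s1 rD pq) (wave_null_proj s2 rD pq).
have dyu q : ball p r q -> du y q = dv x q.
  move=> /(dy q (1, 0)) [_ E]; refine (etrans E _).
  by rewrite /= scale0r add0r scale1r.
have dyv q : ball p r q -> dv y q = du x q.
  move=> /(dy q (0, 1)) [_ E]; refine (etrans E _).
  by rewrite /= scale0r addr0 scale1r.
have oU : open (ball p r) by exact: (ball_open p r).
exists (ball p r), y; split.
- by split; [exact: oU | exact: connected_ball | exists p; exact: ballxx].
- by split; [exact: UD | exact: ballxx].
- have yc q : ball p r q -> {for q, continuous y}.
    move=> pq; have cx q' : ball p r q' -> {for q', continuous x}.
      by move=> /UD; exact: (sx 0%N).1.
    apply: cvgB.
      exact: continuous_comp (@continuous_null_proj 1 p q) (cx _ (ball_null_proj s1 pq)).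
    exact: continuous_comp (@continuous_null_proj (-1) p q) (cx _ (ball_null_proj s2 pq)).
  case=> [|k] /=; first by split.
  have [_ [_ su sv]] := sx k.+1.
  split; first exact: yc.
  split.
  + move=> q pq; split; first by case: (dy q (1, 0) pq).
    by case: (dy q (0, 1) pq).
  + exact: Ck_ext oU (fun q pq => esym (dyu q pq)) (Ck_subset UD sv).
  + exact: Ck_ext oU (fun q pq => esym (dyv q pq)) (Ck_subset UD su).
- by move=> q pq; exact: conj (dyu q pq) (dyv q pq).
Qed.

End Conjugate.

Theorem theorem4p2 (R : realType) (n : nat) :
  (forall (D : set (R * R)) (x : R * R -> 'rV[R]_n),
     timelike_surface x D -> isothermal x D -> minimal x D ->
     forall p : R * R, D p ->
     exists (U : set (R * R)) (Psi : dnum R -> 'rV[dnum R]_n),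
       [/\ domain U /\ (U `<=` D /\ U p),
           holomorphic U Psi,
           forall q, U q -> Dsq (Dd Psi q) = 0,
           forall q, U q -> Dnormsq (Dd Psi q) < 0 &
           forall q, U q -> x q = rowRe (Psi (dnum_of_pair q))]) /\
  (forall (D : set (R * R)) (Psi : dnum R -> 'rV[dnum R]_n),
     domain D ->
     holomorphic D Psi ->
     (forall q, D q -> Dsq (Dd Psi q) = 0) ->
     (forall q, D q -> Dnormsq (Dd Psi q) < 0) ->
     let x : R * R -> 'rV[R]_n := fun q => rowRe (Psi (dnum_of_pair q)) in
     [/\ timelike_surface x D, isothermal x D & minimal x D]).
Proof.
split=> [D x [[oD _ _] sx _ _] iso min p Dp|D Psi dD [sx sy hol] sq nsq x].
  have wave := isothermal_wave oD sx iso min.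
  have [U [y [dU [UD Up] sy dy]]] := wave_conjugate oD sx wave Dp.
  pose Psi t := rowD (x (pair_of_dnum t)) (y (pair_of_dnum t)).
  have pairK q : pair_of_dnum (dnum_of_pair q) = q by case: q.
  have re : (fun q => rowRe (Psi (dnum_of_pair q))) = x.
    by apply/funext => q; rewrite /Psi rowRe_rowD pairK.
  have im : (fun q => rowIm (Psi (dnum_of_pair q))) = y.
    by apply/funext => q; rewrite /Psi rowIm_rowD pairK.
  have hol q : U q -> Ddbar Psi q = 0.
    move=> Uq; apply/Ddbar_eq0; rewrite re im.
    by have [e1 e2] := dy q Uq; exact: conj (esym e2) (esym e1).
  have DdE q : U q -> Dd Psi q = rowD (du x q) (dv x q).
    by move=> /hol /Dd_holomorphic; rewrite re.
  have null q (Uq : U q) := (null_rowD _ _).1 (iso q (UD q Uq)).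
  exists U, Psi; split.
  - by split.
  - by split=> //; [rewrite re => k; exact: Ck_subset UD (sx k) | rewrite im].
  - by move=> q Uq; rewrite DdE //; exact: (null q Uq).1.
  - by move=> q Uq; rewrite DdE //; exact: (null q Uq).2.
  - by move=> q Uq; rewrite -[in LHS]re.
have iso : isothermal x D.
  move=> q Dq; have := sq q Dq; have := nsq q Dq.
  rewrite (Dd_holomorphic (hol q Dq)) => h1 h2; exact: (null_rowD _ _).2 (conj h2 h1).
have tl : timelike_surface x D.
  split=> // q Dq; have [E F E0] := iso q Dq.
    apply: isothermal_immersion => //; first by rewrite lt_eqF.
    by move: E0; rewrite E oppr_lt0 => E0; rewrite gt_eqF.
  split; [exists (1, 0) | exists (0, 1)]; rewrite metricE /=.
    by rewrite !(mul0r, mulr0, addr0, mul1r).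
  rewrite !(mul0r, mulr0, addr0, add0r, mul1r).
  by move: E0; rewrite E oppr_lt0.
refine (And3 tl iso (wave_minimal sx tl iso _)) => q Dq.
have [oD _ _] := dD.
have xu r (Dr : D r) := ((Ddbar_eq0 Psi r).1 (hol r Dr)).1.
have xv r (Dr : D r) := ((Ddbar_eq0 Psi r).1 (hol r Dr)).2.
refine (etrans (du_ext oD xu Dq) (etrans _ (esym (dv_ext oD xv Dq)))).
have E := du_dv_comm oD (sy 2%N) Dq; exact: E.
Qed.
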